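(* Let $(W,S)$ be a finite Coxeter system. For all $u,v\in W$ with $u\leq v$ in Bruhat order, the Bruhat interval $[u,v]=\{z\in W: u\leq z\leq v\}$ is a Coxeter matroid (with respect to the trivial parabolic subgroup, i.e. $J=\emptyset$, identifying $W/W_\emptyset$ with $W$).
   Context: For $w\in W$, the $w$-Bruhat order is defined by $x\leq^w y$ iff $w^{-1}x\leq w^{-1}y$ (Bruhat order). For $J\subseteq S$, and left cosets $A,B\in W/W_J$, write $A\leq^w B$ if there exist $x\in A$, $y\in B$ with $x\leq^w y$. A nonempty subset $\mathcal M\subseteq W/W_J$ is a Coxeter matroid if it satisfies the Maximality Property: for every $w\in W$ there is a unique $A\in\mathcal M$ such that $B\leq^w A$ for all $B\in\mathcal M$. (By the Gelfand–Serganova theorem this is equivalent to: every edge of the polytope $\Delta_{\mathcal M}$, the convex hull of $\{v(p): vW_J\in\mathcal M\}$ for a point $p$ in the standard geometric representation space $V$ with $(p,\alpha_s)<0$ for $s\notin J$ and $(p,\alpha_s)=0$ for $s\in J$, is parallel to a root.) *)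

(* Defs.v *)
From HB Require Import structures.
From mathcomp Require Import all_boot all_fingroup.
From Stdlib Require Import Relations.

Set Implicit Arguments.
Unset Strict Implicit.
Unset Printing Implicit Defensive.

Local Open Scope group_scope.

(* The presentation property: W is presented by the generators S subject to
   the relations (s t)^{m(s,t)} = 1, where m(s,t) = #[s * t] is the order of
   st in W (in particular m(s,s) = 1, i.e. s^2 = 1).  Stated as the universal
   property of the presented group, quantifying over ALL groups H (groupType,
   not necessarily finite). *)
Definition coxeter_presentation (gT : finGroupType) (W : {group gT})
    (S : {set gT}) : Prop :=
  forall (H : groupType) (f : gT -> H),
    (forall s t, s \in S -> t \in S -> (f s * f t) ^+ #[s * t] = 1) ->
    exists phi : gT -> H,
      {in W &, forall x y, phi (x * y) = phi x * phi y} /\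
      {in S, forall s, phi s = f s}.

Definition coxeter_system (gT : finGroupType) (W : {group gT})
    (S : {set gT}) : Prop :=
  [/\ S \subset W, W :=: <<S>>,
      {in S, forall s, s != 1 /\ s * s = 1} &
      coxeter_presentation W S].

Definition is_word (gT : finGroupType) (S : {set gT}) (s : seq gT) (w : gT) :=
  all (mem S) s && (\prod_(x <- s) x == w).

Definition length_is (gT : finGroupType) (S : {set gT}) (w : gT) (n : nat) :=
  (exists s, is_word S s w /\ size s = n) /\
  (forall s, is_word S s w -> (n <= size s)%N).

Definition reflections (gT : finGroupType) (W : {group gT}) (S : {set gT}) :
  {set gT} := [set s ^ w | s in S, w in W].

Definition bruhat_step (gT : finGroupType) (W : {group gT}) (S : {set gT})
    (u w : gT) : Prop :=
  u^-1 * w \in reflections W S /\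
  exists m n, [/\ length_is S u m, length_is S w n & (m < n)%N].

Definition bruhat_le (gT : finGroupType) (W : {group gT}) (S : {set gT}) :
  relation gT := clos_refl_trans gT (bruhat_step W S).

Definition wbruhat_le (gT : finGroupType) (W : {group gT}) (S : {set gT})
    (w x y : gT) : Prop :=
  bruhat_le W S (w^-1 * x) (w^-1 * y).

Definition coset_wle (gT : finGroupType) (W : {group gT}) (S : {set gT})
    (w : gT) (A B : {set gT}) : Prop :=
  exists x y, [/\ x \in A, y \in B & wbruhat_le W S w x y].

Definition coxeter_matroid (gT : finGroupType) (W : {group gT})
    (S J : {set gT}) (M : {set {set gT}}) : Prop :=
  [/\ J \subset S, M \subset lcosets <<J>> W, M != set0 &
      forall w, w \in W ->
        exists! A, A \in M /\ forall B, B \in M -> coset_wle W S w B A].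

(* Main.v *)
(* Write eta w t for "t w < w"; it is a cocycle, read off from the action of W
   on signed reflections. Fix x. A sink of [u, v] is a z in [u, v] such that
   every reflection neighbour of z in [u, v] becomes smaller than x z after
   multiplication by x. Climbing along reflections, every element of [u, v] lies
   below a sink in the x-order, so it suffices that the sink is unique.
   Follow a reduced word of w0 x, extended on the left to one of the longest
   element w0; it induces a total order on the reflections whose initial segment
   consists of the t with x t > x. In the Hecke module, expanding
   T_(x_i)^-1 T_(x_i y) for the successive right factors x_i of w0 shows that
   the R-polynomial of (u, y) counts label-increasing paths from u to y in the
   Bruhat graph (Dyer); its leading coefficient is 1, so every interval has
   exactly one increasing maximal chain. If z is a sink, the increasing chains
   of [u, z] and [z, v] only use labels from the initial and from the final
   segment respectively, so together they form the increasing chain of [u, v],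
   and z is where that chain changes segment. *)
Require Import Defs.
From HB Require Import structures.
From mathcomp Require Import all_boot all_fingroup.
From Stdlib Require Import Relations.
From mathcomp Require Import zify.

Local Open Scope group_scope.

(** * Signed reflections and the sign cocycle *)

Section SignedReflections.

Set Implicit Arguments.
Unset Strict Implicit.
Variable gT : finGroupType.
Implicit Types (r s t x y : gT) (b : bool).

Definition sign_act s (p : gT * bool) : gT * bool :=
  (p.1 ^ s, p.2 (+) (p.1 == s)).

Lemma sign_act_inj s : injective (sign_act s).
Proof.
move=> [x b] [y c] [/conjg_inj-> ] /=.
by case: b c (y == s) => [] [] [].
Qed.

Definition sign_perm s : {perm gT * bool} := perm (@sign_act_inj s).

(** Locates the elements at which one round of [s], then [t], flips the sign: two consecutive terms
    of the sequence [(s * t) ^+ j * s]. *)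
Lemma conj_dihedral s t r n : s * s = 1 -> t * t = 1 ->
  ((r ^ ((s * t) ^+ n) == s) = (r == (s * t) ^+ n.*2 * s)) *
  (((r ^ ((s * t) ^+ n)) ^ s == t) = (r == (s * t) ^+ n.*2.+1 * s)).
Proof.
move=> ss tt.
have sV : s^-1 = s by apply/eqP; rewrite eq_invg_mul ss.
have tV : t^-1 = t by apply/eqP; rewrite eq_invg_mul tt.
have conjs : s * (s * t) ^- n = (s * t) ^+ n * s.
  by rewrite -expVgn invMg sV tV; elim: n => [|n IH];
    rewrite ?expg0 ?mulg1 ?mul1g // expgSr mulgA IH expgSr -!mulgA.
have eqJ x y z : (x ^ y == z) = (x == z ^ y^-1).
  by apply/eqP/eqP => [<-|->]; rewrite -conjgM ?mulgV ?mulVg conjg1.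
have key : s ^ ((s * t) ^- n) = (s * t) ^+ n.*2 * s.
  by rewrite conjgE invgK conjs mulgA -expgD addnn.
split; first by rewrite eqJ key.
rewrite eqJ eqJ sV.
suff -> : (t ^ s) ^ ((s * t) ^- n) = (s * t) ^+ n.*2.+1 * s by [].
rewrite conjgE invgK conjgE sV -!mulgA conjs !mulgA -(mulgA _ s t) -expgSr.
by rewrite -expgD addSn addnn.
Qed.

Lemma sign_perm_expg s t r b n : s * s = 1 -> t * t = 1 ->
  ((sign_perm s * sign_perm t) ^+ n) (r, b) =
  (r ^ ((s * t) ^+ n),
   b (+) \big[addb/false]_(0 <= j < n.*2) (r == (s * t) ^+ j * s)).
Proof.
move=> ss tt; elim: n => [|n IH].
  by rewrite !expg0 perm1 conjg1 big_geq // addbF.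
rewrite expgSr permM IH permM !permE /sign_act /=.
rewrite !(conj_dihedral r n ss tt) doubleS (expgSr _ n) !conjgM; congr (_, _).
by rewrite big_nat_recr // big_nat_recr //= !addbA.
Qed.

(* The values (st)^j s for 0 <= j < 2m, m the order of st, run twice through
   the same list, so the sign changes cancel. *)
Lemma sign_perm_relation s t : s * s = 1 -> t * t = 1 ->
  (sign_perm s * sign_perm t) ^+ #[s * t] = 1.
Proof.
move=> ss tt; apply/permP => -[r b].
rewrite sign_perm_expg // expg_order conjg1 perm1; congr (_, _).
set m := #[_]; rewrite -addnn (big_cat_nat _ (n := m)) ?leq_addr //=.
rewrite -{2}(add0n m) big_addn addnK.
under [X in _ (+) (_ (+) X)]eq_bigr do rewrite expgD expg_order mulg1.
by rewrite addbb addbF.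
Qed.

End SignedReflections.

(** The presentation extends [sign_perm] to a morphism [phi] on [W]; [eta w t] is the sign that [t]
    picks up under [phi w], and multiplicativity of [phi] is the cocycle identity. *)
Lemma coxeter_sign_cocycle (gT : finGroupType) (W : {group gT}) (S : {set gT}) :
  coxeter_system W S ->
  exists eta : gT -> gT -> bool,
    {in W &, forall x y t, eta (x * y) t = eta x t (+) eta y (t ^ x)} /\
    {in S, forall s t, eta s t = (t == s)}.
Proof.
case=> SW defW Sinv presW.
have [s t Ss St|phi [phiM phiS]] := presW {perm gT * bool} (@sign_perm gT).
  by apply: sign_perm_relation; [case: (Sinv s Ss) | case: (Sinv t St)].
pose eta w t := (phi w (t, false)).2.
have phi1 : phi 1 = 1.
  by apply: (mulgI (phi 1)); rewrite -phiM ?group1 // !mulg1.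
have phiE w : w \in W -> forall t b, phi w (t, b) = (t ^ w, b (+) eta w t).
  rewrite {1}defW => /gen_prodgP[n [c Sc ->]].
  elim: n c Sc => [|n IH] c Sc t b.
    by rewrite /eta !big_ord0 phi1 !perm1 conjg1 /= addbF.
  have Wc i : c i \in W by apply: (subsetP SW).
  rewrite /eta !big_ord_recr /= phiM ?Wc ?group_prod // !permM.
  rewrite !IH // !phiS // !permE /sign_act /= -!conjgM.
  by rewrite addbA.
exists eta; split=> [x y Wx Wy t | s Ss t].
  by rewrite {1}/eta phiM // permM phiE // phiE.
by rewrite /eta phiS // permE.
Qed.

Lemma length_function (gT : finGroupType) (W : {group gT}) (S : {set gT}) :
  W :=: <<S>> -> exists len : gT -> nat, {in W, forall w, length_is S w (len w)}.
Proof.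
move=> defW.
have [w|len lenP] := @fin_all_exists gT (fun=> nat)
    (fun w n => w \in W -> length_is S w n); last by exists len => w; apply: lenP.
(* Outside [W] the value 0 is a mere default. *)
have [Ww|] := boolP (w \in W); last by exists 0%N.
pose P n := [exists s : n.-tuple gT, is_word S s w].
have exP : exists n, P n.
  move: Ww; rewrite defW => /gen_prodgP[n [c Sc def_w]].
  exists n; apply/existsP; exists [tuple c i | i < n].
  apply/andP; split; first by apply/allP => _ /mapP[i _ ->]; apply: Sc.
  by rewrite def_w big_tuple; apply/eqP/eq_bigr => i _; rewrite tnth_mktuple.
case: (ex_minnP exP) => n /existsP[s ws] min_n; exists n => _; split.
  by exists s; rewrite size_tuple.
by move=> s' ws'; apply: min_n; apply/existsP; exists (in_tuple s').
Qed.

(** * Length and descents read off from the cocycle *)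

Section CoxeterGroup.

Set Implicit Arguments.
Unset Strict Implicit.
Variables (gT : finGroupType) (W : {group gT}) (S : {set gT}).
Variables (eta : gT -> gT -> bool) (len : gT -> nat).
Hypothesis SW : S \subset W.
Hypothesis S_invol : {in S, forall s, s * s = 1}.
Hypothesis etaM :
  {in W &, forall x y t, eta (x * y) t = eta x t (+) eta y (t ^ x)}.
Hypothesis etaS : {in S, forall s t, eta s t = (t == s)}.
Hypothesis lenP : {in W, forall w, length_is S w (len w)}.

Implicit Types (r s t u v w x y z : gT) (ws ts : seq gT).
Local Notation T := (reflections W S).
Local Notation word ws := (\prod_(s <- ws) s).
Local Notation bruhat := (bruhat_le W S).

Lemma gen_mem s : s \in S -> s \in W. Proof. exact: (subsetP SW). Qed.
#[local] Hint Extern 0 (is_true (_ \in _)) => apply: gen_mem; assumption : core.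

Lemma genV s : s \in S -> s^-1 = s.
Proof. by move=> Ss; apply/eqP; rewrite eq_invg_mul S_invol. Qed.

Lemma conjgg x : x ^ x = x. Proof. by rewrite conjgE mulKg. Qed.

Lemma word_mem ws : all (mem S) ws -> word ws \in W.
Proof.
by move=> /allP Sws; rewrite big_seq; apply: group_prod => s /Sws; apply: gen_mem.
Qed.

Lemma refl_mem t : t \in T -> t \in W.
Proof. by case/imset2P => s w Ss Ww ->; rewrite groupJ. Qed.
#[local] Hint Extern 0 (is_true (_ \in _)) => apply: refl_mem; assumption : core.

Lemma gen_refl s : s \in S -> s \in T.
Proof. by move=> Ss; apply/imset2P; exists s 1; rewrite ?group1 ?conjg1. Qed.
#[local] Hint Extern 0 (is_true (_ \in _)) => apply: gen_refl; assumption : core.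

Lemma reflJ t w : t \in T -> w \in W -> t ^ w \in T.
Proof.
case/imset2P => s x Ss Wx -> Ww; apply/imset2P.
by exists s (x * w); rewrite ?groupM ?conjgM.
Qed.

Lemma reflK t : t \in T -> t * t = 1.
Proof. by case/imset2P => s w Ss _ ->; rewrite -conjMg S_invol // conj1g. Qed.

Lemma len_le ws : all (mem S) ws -> len (word ws) <= size ws.
Proof.
by move=> Sws; apply: (lenP (word_mem Sws)).2; rewrite /is_word Sws eqxx.
Qed.

Lemma len_word w : w \in W ->
  exists ws, [/\ all (mem S) ws, word ws = w & size ws = len w].
Proof.
by case/lenP => [[ws [/andP[Sws /eqP <-] <-]] _]; exists ws.
Qed.

Lemma length_is_mem w n : length_is S w n -> w \in W.
Proof. by case=> [[ws [/andP[Sws /eqP <-] _]] _]; apply: word_mem. Qed.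

Lemma length_isE w n : length_is S w n -> n = len w.
Proof.
move=> lwn; have Ww := length_is_mem lwn.
have [[ws1 [w1 <-]] min1] := lwn; have [[ws2 [w2 s2]] min2] := lenP Ww.
by apply/eqP; rewrite eqn_leq -{1}s2 min1 // min2.
Qed.

Lemma eta1 t : eta 1 t = false.
Proof.
by have := etaM (group1 W) (group1 W) t; rewrite mulg1 conjg1 addbb.
Qed.

Lemma etaV x t : x \in W -> eta x^-1 t = eta x (t ^ x^-1).
Proof.
move=> Wx; have := etaM Wx (groupVr Wx) (t ^ x^-1).
by rewrite mulgV eta1 conjgKV; case: (eta x _); case: (eta _ t).
Qed.

(** Strong exchange: some letter must flip the sign of [t]; there [t] is that letter conjugated by
    the prefix before it, so left multiplication by [t] erases it. *)
Lemma eta_delete ws t : all (mem S) ws -> eta (word ws) t ->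
  exists ws', [/\ all (mem S) ws', size ws = (size ws').+1 &
                  word ws' = t * word ws].
Proof.
elim: ws t => [|s ws IH] t /=; first by rewrite big_nil eta1.
case/andP => Ss Sws; rewrite big_cons etaM ?word_mem // etaS //.
have [-> _|_ /= /(IH _ Sws)[ws' [Sws' sz eqw]]] := eqVneq t s.
  by exists ws; rewrite mulgA S_invol // mul1g.
exists (s :: ws') => /=; rewrite Ss sz; split=> //.
by rewrite big_cons eqw conjgE genV // !mulgA S_invol // mul1g.
Qed.

Lemma eta_len w t : w \in W -> eta w t -> len (t * w) < len w.
Proof.
move=> /len_word[ws [Sws <- <-]] /(eta_delete Sws)[ws' [Sws' -> <-]].
by rewrite ltnS len_le.
Qed.

(** For [t = s ^ w] the contributions of [w] and [w^-1] cancel, leaving the single flip of [s]. *)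
Lemma eta_refl t : t \in T -> eta t t.
Proof.
case/imset2P => s w Ss Ww ->; rewrite {1}conjgE.
rewrite !etaM ?groupM ?groupV // etaV // conjgK.
rewrite (etaS Ss) eqxx conjgg.
by case: (eta w s).
Qed.

Lemma eta_mull t w : t \in T -> w \in W -> eta (t * w) t = ~~ eta w t.
Proof. by move=> Tt Ww; rewrite etaM // eta_refl // conjgg. Qed.

Lemma eta_lenN w t : t \in T -> w \in W -> ~~ eta w t -> len w < len (t * w).
Proof.
move=> Tt Ww; rewrite -eta_mull // => /eta_len.
by rewrite mulgA reflK // mul1g; apply; rewrite groupM.
Qed.

Lemma eta_len1l s w : s \in S -> w \in W -> eta w s ->
  len w = (len (s * w)).+1.
Proof.
move=> Ss Ww /(eta_len Ww) lt_sw; apply/eqP; rewrite eqn_leq lt_sw andbT.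
have [ws [Sws def_w <-]] := len_word (groupM (gen_mem Ss) Ww).
have <- : word (s :: ws) = w by rewrite big_cons def_w mulgA S_invol ?mul1g.
by apply: len_le => /=; rewrite Ss.
Qed.

(** Since [r ^ w^-1 * w = w * r], descents on the right are written [eta w (r ^ w^-1)] from here
    on. *)
Lemma eta_len1r r w : r \in S -> w \in W -> eta w (r ^ w^-1) ->
  len w = (len (w * r)).+1.
Proof.
move=> Sr Ww /(eta_len Ww); rewrite -conjgCV => lt_wr.
apply/eqP; rewrite eqn_leq lt_wr andbT.
have [ws [Sws def_w <-]] := len_word (groupM Ww (gen_mem Sr)).
have <- : word (rcons ws r) = w.
  by rewrite -cats1 big_cat /= big_seq1 def_w -mulgA S_invol ?mulg1.
by rewrite -(size_rcons ws r) len_le // all_rcons /= Sr.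
Qed.

Lemma eta_mulr r w : r \in S -> w \in W ->
  eta (w * r) (r ^ (w * r)^-1) = ~~ eta w (r ^ w^-1).
Proof.
move=> Sr Ww; rewrite etaM // (etaS Sr).
rewrite invMg conjgM (genV Sr) conjgg conjgKV eqxx.
by case: (eta _ _).
Qed.

Lemma eta_mull_conj s w t : s \in S -> w \in W ->
  eta (s * w) (t ^ (s * w)^-1) = (s ^ w == t) (+) eta w (t ^ w^-1).
Proof.
move=> Ss Ww; have sK z : (z ^ s) ^ s = z by rewrite -conjgM S_invol // conjg1.
rewrite etaM // (etaS Ss) invMg conjgM (genV Ss) sK; congr (_ (+) _).
rewrite -{2}(conjgg s) (inj_eq (@conjg_inj _ s)).
by apply/eqP/eqP => [<-|<-]; rewrite ?conjgKV ?conjgK.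
Qed.

(** * Bruhat order, lifting and the longest element *)

Lemma bruhat_stepP a b : a \in W -> bruhat_step W S a b <->
  exists t, [/\ t \in T, ~~ eta a t & b = t * a].
Proof.
move=> Wa; split=> [[Tab [m [n [la lb lt_mn]]]] | [t [Tt Nat ->]]].
  have Wb := length_is_mem lb.
  exists (b * a^-1).
  have -> : b * a^-1 = (a^-1 * b) ^ a^-1.
    by rewrite conjgE invgK -!mulgA mulKVg.
  split; [by rewrite reflJ ?groupV | | by rewrite -conjgCV mulKVg].
  apply: contraL lt_mn => /(eta_len Wa); rewrite -conjgCV mulKVg.
  by rewrite (length_isE la) (length_isE lb) -leqNgt => /ltnW.
split; first by rewrite -conjgE reflJ.
exists (len a), (len (t * a)).
by split; [exact: lenP | apply: lenP; rewrite groupM | exact: eta_lenN].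
Qed.

Lemma bruhat_refl a : bruhat a a. Proof. exact: rt_refl. Qed.

Lemma bruhat_trans a b c : bruhat a b -> bruhat b c -> bruhat a c.
Proof. exact: rt_trans. Qed.

Lemma bruhat_up a t : a \in W -> t \in T -> ~~ eta a t -> bruhat a (t * a).
Proof. by move=> Wa Tt Nat; apply/rt_step/bruhat_stepP => //; exists t. Qed.

Lemma bruhat_down a t : a \in W -> t \in T -> eta a t -> bruhat (t * a) a.
Proof.
move=> Wa Tt at_; have def_a : a = t * (t * a) by rewrite mulgA reflK ?mul1g.
rewrite {2}def_a; apply: bruhat_up; rewrite ?groupM //.
by rewrite eta_mull // at_.
Qed.

Lemma bruhat_mem a b : a \in W -> bruhat a b -> b \in W.
Proof.
move=> Wa /(clos_rt_rt1n gT) ab; elim: ab Wa => // x y z xy _ IH Wx.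
by apply: IH; have [t [Tt _ ->]] := (bruhat_stepP y Wx).1 xy; rewrite groupM.
Qed.

Lemma bruhat_len a b : a \in W -> bruhat a b -> a = b \/ len a < len b.
Proof.
move=> Wa /(clos_rt_rt1n gT) ab; elim: ab Wa => [|x y z xy _ IH] Wx; first by left.
have [t [Tt Nxt def_y]] := (bruhat_stepP y Wx).1 xy.
have lt_xy : len x < len y by rewrite def_y eta_lenN.
have [|<-|lt_yz] := IH; [by rewrite def_y groupM | by right | right].
exact: ltn_trans lt_yz.
Qed.

Lemma bruhat_len_le a b : a \in W -> bruhat a b -> len a <= len b.
Proof. by move=> Wa /(bruhat_len Wa)[->|/ltnW]. Qed.

Lemma bruhat_step_mulr a b r : a \in W -> r \in S -> bruhat_step W S a b ->
  a * r = b \/ bruhat_step W S (a * r) (b * r).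
Proof.
move=> Wa Sr /(bruhat_stepP b Wa)[t [Tt Nat ->]].
have [def_t|neq] := eqVneq (t ^ a) r; [left | right].
  by rewrite -def_t conjgE mulKVg.
apply/bruhat_stepP; first by rewrite groupM.
by exists t; rewrite mulgA etaM // (etaS Sr) (negPf neq) addbF.
Qed.

(** The lifting property, by induction along a chain: the only step from [y] to [z] that [r] does
    not preserve is [z = y * r], and then [z * r] is [y] itself. *)
Lemma bruhat_lift_down a b r : a \in W -> r \in S -> ~~ eta a (r ^ a^-1) ->
  bruhat a b -> bruhat a (b * r).
Proof.
move=> Wa Sr Nar /(clos_rt_rtn1 gT); elim=> [|y z yz ay IH].
  by rewrite conjgCV; apply: bruhat_up; rewrite ?reflJ ?groupV.
have {}ay : bruhat a y by apply: clos_rtn1_rt.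
have Wy := bruhat_mem Wa ay.
have [<- |yrzr] := bruhat_step_mulr Wy Sr yz; first by rewrite -mulgA S_invol ?mulg1.
by apply: bruhat_trans IH _; apply: rt_step.
Qed.

Lemma right_descent y : y \in W -> y != 1 ->
  exists2 r, r \in S & eta y (r ^ y^-1).
Proof.
move=> Wy; have [ws [Sws def_y sz]] := len_word Wy; rewrite -{1}def_y.
case/lastP: ws => [|ws r] in Sws def_y sz *; first by rewrite big_nil eqxx.
move: Sws; rewrite all_rcons => /andP[/= Sr Sws] _; exists r => //.
apply: contraT => /eta_lenN; rewrite -conjgCV reflJ ?groupV //.
move=> /(_ isT Wy); rewrite -sz size_rcons -def_y -cats1 big_cat /= big_seq1.
by rewrite -mulgA S_invol // mulg1 // ltnNge (leqW (len_le Sws)).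
Qed.

Lemma longest_element : exists2 w0, w0 \in W & {in T, forall t, eta w0 t}.
Proof.
exists [arg max_(w > 1 in W) len w]; case: arg_maxnP => // w0 Ww0 max_w0 //.
move=> t Tt; apply: contraT => /(eta_lenN Tt Ww0); rewrite ltnNge.
by move/negP; case; apply: max_w0; rewrite groupM.
Qed.

(** * Label-increasing paths and the Hecke module *)

Fixpoint labels ws :=
  if ws is s :: ws' then s ^ word ws' :: labels ws' else [::].

(** Each letter lengthens the word to its right, so the word is reduced. *)
Fixpoint ascending ws :=
  if ws is s :: ws'
  then [&& s \in S, ~~ eta (word ws') s & ascending ws'] else true.

Lemma ascending_all ws : ascending ws -> all (mem S) ws.
Proof. by elim: ws => //= s ws IH /and3P[-> _ /IH]. Qed.

Lemma labels_refl ws : all (mem S) ws -> all (mem T) (labels ws).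
Proof.
elim: ws => //= s ws IH /andP[Ss Sws]; rewrite IH // andbT.
by rewrite reflJ ?word_mem // gen_refl.
Qed.

(** Multiplication by q on coefficient sequences. *)
Definition shift (f : nat -> nat) k := if k is k'.+1 then f k' else 0%N.

(* Counts the paths of length k from v down to u in the Bruhat graph whose
   labels, read downwards, form a subsequence of ts. *)
Fixpoint paths ts v u k : nat :=
  if ts is t :: ts'
  then paths ts' v u k + eta v t * shift (paths ts' (t * v) u) k
  else (v == u) && (k == 0).

Definition delta a u (k : nat) : nat := (a == u) && (k == 0).

(* With q-polynomials F u = \sum_k F u k q^k, opl s is left multiplication by
   T_s^-1 (q the structure constant, up to sign) on the Hecke module with
   basis W, and opr r is its right-handed version. *)
Definition opl s (F : gT -> nat -> nat) u k : nat :=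
  F (s * u) k + ~~ eta u s * shift (F u) k.

Definition opr r (F : gT -> nat -> nat) u k : nat :=
  F (u * r) k + ~~ eta u (r ^ u^-1) * shift (F u) k.

(** The first letter acts first, so a reduced word of x acts as T_x^-1. *)
Fixpoint opw ws F := if ws is s :: ws' then opw ws' (opl s F) else F.

Lemma eq_shift f g k : f =1 g -> shift f k = shift g k.
Proof. by move=> eq_fg; case: k => //= k. Qed.

Lemma eq_opw ws F G : all (mem S) ws -> {in W, F =2 G} ->
  {in W, opw ws F =2 opw ws G}.
Proof.
elim: ws F G => //= s ws IH F G /andP[Ss Sws] eqFG; apply: IH => // u Wu k.
rewrite /opl eqFG ?groupM //; congr (_ + _ * _)%N.
by apply: eq_shift => j; apply: eqFG.
Qed.

Lemma opw_linear ws F G (b : nat) : all (mem S) ws ->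
  {in W, opw ws (fun u k => F u k + b * shift (G u) k)%N =2
         fun u k => (opw ws F u k + b * shift (opw ws G u) k)%N}.
Proof.
elim: ws F G => //= s ws IH F G /andP[Ss Sws] u Wu k.
rewrite -IH //; apply: eq_opw => // x Wx j; rewrite /opl.
by case: j => [|[|j]] /=; nia.
Qed.

(** With x the word after [s], T_s^-1 T_(sxy) is T_(xy), plus q T_(sxy) if sxy < xy fails. As sx = x
    [s ^ x], the two terms are the paths that omit or use the label [s ^ x]; sx > x turns the
    condition into a descent of [y]. *)
Lemma opw_paths ws y : ascending ws -> y \in W ->
  {in W, opw ws (delta (word ws * y)) =2 paths (labels ws) y}.
Proof.
elim: ws y => [|s ws IH] y; first by rewrite big_nil mul1g.
case/and3P => Ss Nxs asc Wy u Wu k /=; have Sws := ascending_all asc.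
have Wx := word_mem Sws; have Wt : s ^ word ws \in W by rewrite groupJ.
rewrite big_cons -(IH _ asc Wy _ Wu).
have -> : shift (paths (labels ws) (s ^ word ws * y) u) k =
    shift (opw ws (delta (word ws * (s ^ word ws * y))) u) k.
  by apply: eq_shift => j; rewrite (IH _ asc (groupM Wt Wy)).
rewrite -opw_linear //; apply: eq_opw => // {Wu k}u Wu k.
rewrite /opl /delta.
have -> : word ws * (s ^ word ws * y) = s * word ws * y.
  by rewrite conjgE !mulgA mulgV mul1g.
rewrite -(mulgA s) (inj_eq (mulgI s)); congr (_ + _)%N.
case: k => [|k] /=; first by rewrite !muln0.
have [<-|] := eqVneq (s * _) u; last by rewrite !muln0.
by rewrite eta_mull ?groupM // negbK etaM // (negPf Nxs).
Qed.

Lemma paths1 ts u k : paths ts 1 u k = delta 1 u k.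
Proof. by elim: ts => //= t ts ->; rewrite eta1 mul0n addn0. Qed.

Lemma opr_opl r s F : r \in S -> s \in S ->
  {in W, opr r (opl s F) =2 opl s (opr r F)}.
Proof.
move=> Sr Ss u Wu k; rewrite /opr /opl.
rewrite eta_mull_conj // etaM // (etaS Sr).
(* The two descent conditions interact only if [s * u = u * r]. *)
have [def_r|_] := eqVneq (s ^ u) r; last first.
  rewrite !mulgA; case: k => [|[|k]]; case: (eta u s);
    by case: (eta u _); rewrite /= ?mul0n ?mul1n ?addn0 //;
       first [rewrite addnACA | rewrite addnAC].
rewrite -mulgA -def_r conjgK (conjgCV u) conjgK.
by case: k => [|[|k]]; case: (eta u s); rewrite /= ?mul0n ?mul1n ?addn0.
Qed.

Lemma opr_opw r ws F : r \in S -> all (mem S) ws ->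
  {in W, opr r (opw ws F) =2 opw ws (opr r F)}.
Proof.
move=> Sr; elim: ws F => //= s ws IH F /andP[Ss Sws] u Wu k.
by rewrite IH //; apply: eq_opw => //; apply: opr_opl.
Qed.

(* The leading coefficient of the R-polynomial of (u, y) is 1 if u <= y. *)
Lemma opw_leading w0 ws y : w0 \in W -> {in T, forall t, eta w0 t} ->
  ascending ws -> word ws = w0 -> y \in W -> forall u k, u \in W ->
  (len y < len u + k -> opw ws (delta (w0 * y)) u k = 0%N) /\
  (len y = len u + k -> bruhat u y -> opw ws (delta (w0 * y)) u k = 1%N).
Proof.
move=> Ww0 w0T asc def_w0; have Sws := ascending_all asc.
have [n] := ubnP (len y); elim: n y => // n IH y lt_n Wy u k Wu.
have [-> | /(right_descent Wy)[r Sr yr]] := eqVneq y 1.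
  have len1 : len 1 = 0%N.
    by apply/eqP; rewrite -leqn0; have := @len_le [::] isT; rewrite big_nil.
  rewrite -def_w0 opw_paths // paths1 /delta len1.
  split=> [|/esym/eqP]; first by case: eqP => // <-; rewrite len1; case: k.
  rewrite addn_eq0 => /andP[_ /eqP->] /(bruhat_len Wu)[->|]; first by rewrite eqxx.
  by rewrite len1.
pose y' := y * r; have Wy' : y' \in W by rewrite groupM.
have y'r : ~~ eta y' (r ^ y'^-1) by rewrite eta_mulr // yr.
have leny : len y = (len y').+1 by apply: eta_len1r.
have def_y : y = y' * r by rewrite -mulgA S_invol ?mulg1.
(* The recursion for R-polynomials at a right descent of [y]: as [w0] reverses descents, [opr r]
   sends the basis element at [w0 * y'] to the one at [w0 * y]. *)
have rec : opw ws (delta (w0 * y)) u k = opr r (opw ws (delta (w0 * y'))) u k.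
  rewrite opr_opw //; apply: eq_opw => // {Wu k}u Wu k; rewrite /opr /delta.
  have -> : (w0 * y == u) = (w0 * y' == u * r).
    by rewrite -(inj_eq (mulIg r) (w0 * y')) -!mulgA S_invol // !mulg1.
  case: k => [|k] /=; rewrite ?muln0 ?addn0 // !andbF.
  have [<-|] := eqVneq (w0 * y') u; last by rewrite andFb muln0.
  rewrite etaM // invMg conjgM conjgKV w0T ?(negPf y'r) //.
  by rewrite !reflJ ?groupV.
have {}lt_n : len y' < n by rewrite -ltnS -leny.
have {}IH := IH y' lt_n Wy'.
rewrite rec /opr; have [ur | Nur] := boolP (eta u (r ^ u^-1)) => /=.
  have lenu := eta_len1r Sr Wu ur; have Wur : u * r \in W by rewrite groupM.
  rewrite mul0n addn0 leny lenu addSn; split=> [lt_y | [eq_y] u_le_y].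
    by rewrite ltnS in lt_y; apply: (IH _ k Wur).1.
  apply: (IH _ k Wur).2 => //.
  have Nurr : ~~ eta (u * r) (r ^ (u * r)^-1) by rewrite eta_mulr // ur.
  apply: bruhat_lift_down => //; apply: bruhat_trans u_le_y.
  have {2}-> : u = u * r * r by rewrite -mulgA S_invol ?mulg1.
  by rewrite [X in bruhat _ X]conjgCV; apply: bruhat_up; rewrite ?reflJ ?groupV.
have Wur : u * r \in W by rewrite groupM.
have lenur : len (u * r) = (len u).+1.
  rewrite (@eta_len1r r (u * r)) ?eta_mulr // -mulgA S_invol // mulg1 //.
(* The length gap from [u * r] to [y'] is smaller by two, so in degree [k] only the shifted term can
   survive. *)
have far : len y <= len u + k -> opw ws (delta (w0 * y')) (u * r) k = 0%N.
  by rewrite leny => lt_y; apply: (IH _ k Wur).1; rewrite lenur addSn ltnW.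
rewrite mul1n; split=> [lt_y | eq_y u_le_y].
  rewrite far 1?ltnW // add0n; case: k lt_y {far rec} => //= k.
  by rewrite leny addnS ltnS; apply: (IH u k Wu).1.
have u_le_y' : bruhat u y' by apply: bruhat_lift_down.
rewrite far ?eq_y // add0n; have := bruhat_len_le Wu u_le_y'.
move: eq_y; rewrite leny; case: k {far rec} => [|k]; rewrite (addn0, addnS).
  by move=> <-; rewrite ltnn.
by case=> eq_y _ /=; apply: (IH u k Wu).2.
Qed.

(** * Confining and concatenating increasing paths *)

Lemma shift_gt0 f k : 0 < shift f k -> exists2 k', k = k'.+1 & 0 < f k'.
Proof. by case: k => // k; exists k. Qed.

Lemma paths_bruhat ts v u k : all (mem T) ts -> v \in W ->
  0 < paths ts v u k -> bruhat u v.
Proof.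
elim: ts v k => [|t ts IH] v k /=.
  by move=> _ _; case: eqP => // <- _; apply: bruhat_refl.
case/andP => Tt Tts Wv; rewrite addn_gt0 muln_gt0 => /orP[/IH|/andP[]]; first exact.
case vt: (eta v t) => // _ /shift_gt0[k' _ /IH uv'].
by apply: bruhat_trans (bruhat_down Wv Tt vt); apply: uv'; rewrite ?groupM.
Qed.

(** The first label used acts on [v] itself and must lead to an element above [u], so it cannot come
    from [ts1]. *)
Lemma paths_skip ts1 ts2 v u k : all (mem T) (ts1 ++ ts2) -> v \in W ->
  {in ts1, forall t, eta v t -> ~ bruhat u (t * v)} ->
  paths (ts1 ++ ts2) v u k = paths ts2 v u k.
Proof.
elim: ts1 => //= t ts1 IH /andP[Tt Tts] Wv skip.
rewrite IH // => [|t' t't]; last by apply: skip; rewrite inE t't orbT.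
case vt: (eta v t); last by rewrite mul0n addn0.
have [->|] := posnP (shift (paths (ts1 ++ ts2) (t * v) u) k).
  by rewrite muln0 addn0.
case/shift_gt0 => k' _ /(paths_bruhat Tts) uv.
by case: (skip t (mem_head _ _) vt); apply: uv; rewrite groupM.
Qed.

Lemma paths_stop ts y z k : all (mem T) ts -> y \in W ->
  {in ts, forall t, ~~ eta z t -> ~ bruhat (t * z) y} ->
  0 < paths ts y z k -> y = z /\ k = 0%N.
Proof.
elim: ts y k => [|t ts IH] y k /=.
  by move=> _ _ _; case: eqP => // ->; case: eqP.
case/andP => Tt Tts Wy stop; rewrite addn_gt0 muln_gt0.
have stop_ts : {in ts, forall t, ~~ eta z t -> ~ bruhat (t * z) y}.
  by move=> t' t't; apply: stop; rewrite inE t't orbT.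
case/orP => [/IH|/andP[]]; first exact.
case yt: (eta y t) => // _ /shift_gt0[k' _ /IH ty].
have Wty : t * y \in W by rewrite groupM.
have [|def_z _] := ty Tts Wty.
  move=> t' t't Nzt' t'z; apply: (stop_ts t') => //.
  exact: bruhat_trans t'z (bruhat_down Wy Tt yt).
case: (stop t (mem_head _ _)); rewrite -def_z ?eta_mull ?yt //.
by rewrite mulgA reflK // mul1g; apply: bruhat_refl.
Qed.

(** Dual to [paths_skip]: the last label [t] used enters [z] from [t * z], which is below [y]. *)
Lemma paths_prefix ts1 ts2 y z k : all (mem T) (ts1 ++ ts2) -> y \in W ->
  {in ts2, forall t, ~~ eta z t -> ~ bruhat (t * z) y} ->
  0 < paths (ts1 ++ ts2) y z k -> 0 < paths ts1 y z k.
Proof.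
elim: ts1 y k => [|t ts1 IH] y k /=.
  by move=> Tts Wy stop /(paths_stop Tts Wy stop)[-> ->]; rewrite !eqxx.
case/andP => Tt Tts Wy stop; rewrite !addn_gt0 !muln_gt0.
case/orP => [/(IH _ _ Tts Wy stop)-> //|/andP[]].
case yt: (eta y t) => // _ /shift_gt0[k' -> /= ty].
rewrite (IH (t * y)) ?orbT ?groupM // => t' t't Nzt' t'z; apply: (stop t') => //.
exact: bruhat_trans t'z (bruhat_down Wy Tt yt).
Qed.

Lemma paths_cat_gt0 ts1 ts2 v z u k l :
  0 < paths ts1 v z k -> 0 < paths ts2 z u l ->
  0 < paths (ts1 ++ ts2) v u (k + l).
Proof.
elim: ts1 v k => [|t ts1 IH] v k /=.
  by case: eqP => // ->; case: eqP => // ->.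
rewrite !addn_gt0 !muln_gt0 => /orP[/IH H /H -> //|/andP[-> /shift_gt0[k' ->]]].
by move=> /IH H /H; rewrite addSn /= => ->; rewrite orbT.
Qed.

(** Follow both paths until one uses a label that the other omits; there both summands of [paths]
    are positive. Distinct midpoints force such a label within [ts1]. *)
Lemma paths_cat_gt1 ts1 ts2 v z1 z2 u k1 k2 l1 l2 : z1 != z2 ->
  0 < paths ts1 v z1 k1 -> 0 < paths ts2 z1 u l1 ->
  0 < paths ts1 v z2 k2 -> 0 < paths ts2 z2 u l2 ->
  (k1 + l1 = k2 + l2)%N -> 1 < paths (ts1 ++ ts2) v u (k1 + l1).
Proof.
move=> neq + z1u + z2u; elim: ts1 v k1 k2 => [|t ts1 IH] v k1 k2 /=.
  case: eqP => // ->; case: eqP => // -> _.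
  by rewrite (negPf neq).
rewrite !addn_gt0 !muln_gt0.
have cat z k l : 0 < paths ts2 z u l -> 0 < eta v t ->
    0 < shift (paths ts1 (t * v) z) k ->
    0 < eta v t * shift (paths (ts1 ++ ts2) (t * v) u) (k + l).
  move=> zu vt /shift_gt0[k' -> tvz]; rewrite muln_gt0 vt.
  exact: paths_cat_gt0 tvz zu.
case/orP => [p1|/andP[vt p1]] /orP[p2|/andP[vt' p2]] eq_kl.
- by apply: leq_trans (leq_addr _ _); apply: IH eq_kl.
- rewrite -(addn1 1) leq_add ?(paths_cat_gt0 p1) //.
  by rewrite eq_kl (cat z2).
- rewrite -(addn1 1) leq_add ?(cat z1) //.
  by rewrite eq_kl (paths_cat_gt0 p2).
apply: leq_trans (leq_addl _ _).
case: (eta v t) vt => // _; rewrite mul1n.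
move: p1 p2 eq_kl => /shift_gt0[k1' -> p1] /shift_gt0[k2' -> p2] [eq_kl] /=.
exact: IH p1 p2 eq_kl.
Qed.

(** * Reduced words of the longest element and their labels *)

Lemma left_descent x : x \in W -> x != 1 -> exists2 s, s \in S & eta x s.
Proof.
move=> Wx nx1; have [||s Ss] := @right_descent x^-1; rewrite ?groupV ?invg_eq1 //.
by rewrite etaV // invgK conjgK; exists s.
Qed.

Lemma ascending_word x : x \in W -> exists2 ws, ascending ws & word ws = x.
Proof.
have [n] := ubnP (len x); elim: n x => // n IH x lt_n Wx.
have [->|/(left_descent Wx)[s Ss xs]] := eqVneq x 1; first by exists [::]; rewrite ?big_nil.
have Wsx : s * x \in W by rewrite groupM.
have [|ws asc def_sx] := IH _ _ Wsx.
  by rewrite -ltnS -(eta_len1l Ss Wx xs).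
exists (s :: ws); last by rewrite big_cons def_sx mulgA S_invol ?mul1g.
by rewrite /= Ss asc def_sx eta_mull ?xs // gen_refl.
Qed.

Lemma ascending_extend w0 ws : w0 \in W -> {in T, forall t, eta w0 t} ->
  ascending ws ->
  exists2 ws', ascending (ws' ++ ws) & word (ws' ++ ws) = w0.
Proof.
move=> Ww0 w0T; have [n] := ubnP (len (w0 * (word ws)^-1)).
elim: n ws => // n IH ws lt_n asc.
have Wx := word_mem (ascending_all asc).
have Wv : w0 * (word ws)^-1 \in W by rewrite groupM ?groupV.
have [v1 | /(right_descent Wv)[s Ss vs]] := eqVneq (w0 * (word ws)^-1) 1.
  exists [::] => //=; apply/esym/eqP.
  by rewrite -(inj_eq (mulIg (word ws)^-1)) v1 mulgV.
(* As every reflection is a descent of [w0], a right descent [s] of [w0 * (word ws)^-1] is not a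
   left descent of [word ws]. *)
have asc' : ascending (s :: ws).
  move: vs; rewrite /= Ss asc andbT /= etaM ?groupV //.
  rewrite w0T ?reflJ ?groupV ?gen_refl // etaV // -!conjgM invMg invgK.
  by rewrite !mulgA mulgKV mulgV conjg1.
have [||ws' asc'' def_w0] := IH (s :: ws) => //.
  rewrite big_cons invMg mulgA (genV Ss) -ltnS.
  by rewrite -(eta_len1r Ss Wv vs).
by exists (rcons ws' s); rewrite cat_rcons.
Qed.

(** Passing to [s * w] changes the status of [s ^ w] only, which is not a right descent of [w]. *)
Lemma desc_ascending s w t : s \in S -> w \in W -> ~~ eta w s ->
  eta w (t ^ w^-1) -> eta (s * w) (t ^ (s * w)^-1).
Proof.
move=> Ss Ww Nws wt; rewrite eta_mull_conj // wt.
by case: eqP => // def_t; rewrite -def_t conjgK (negPf Nws) in wt.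
Qed.

Lemma labels_desc ws : ascending ws ->
  {in labels ws, forall t, eta (word ws) (t ^ (word ws)^-1)}.
Proof.
elim: ws => //= s ws IH /and3P[Ss Nws asc] t.
have Wx := word_mem (ascending_all asc).
rewrite inE big_cons => /orP[/eqP-> | /(IH asc)]; last exact: desc_ascending.
by rewrite eta_mull_conj // eqxx conjgK.
Qed.

Lemma desc_cat ws1 ws2 t : ascending (ws1 ++ ws2) ->
  eta (word ws2) (t ^ (word ws2)^-1) ->
  eta (word (ws1 ++ ws2)) (t ^ (word (ws1 ++ ws2))^-1).
Proof.
elim: ws1 => //= s ws1 IH /and3P[Ss Nxs asc] /(IH asc); rewrite big_cons.
by apply: desc_ascending; rewrite ?word_mem ?ascending_all.
Qed.

(** An offending label would remain a descent up to the point where its letter is added,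
    contradicting that this letter ascends. *)
Lemma labels_cat ws1 ws2 : ascending (ws1 ++ ws2) ->
  exists2 ts1, labels (ws1 ++ ws2) = ts1 ++ labels ws2
    & {in ts1, forall t, ~~ eta (word ws2) (t ^ (word ws2)^-1)}.
Proof.
elim: ws1 => [|s ws1 IH] /=; first by exists [::].
case/and3P => Ss Nxs asc; have [ts1 -> ts1P] := IH asc.
exists (s ^ word (ws1 ++ ws2) :: ts1) => // t.
rewrite inE => /orP[/eqP->|]; last exact: ts1P.
by apply: contra Nxs => /(desc_cat asc); rewrite conjgK.
Qed.

(** * Sinks of an interval: uniqueness *)

Definition sink x u v z :=
  [/\ bruhat u z, bruhat z v &
      {in T, forall t, bruhat u (t * z) -> bruhat (t * z) v ->
                       eta (x * z) (t ^ x^-1)}].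

(* ts1 collects the labels t with x * t < x, and labels ws those with
   x * t > x; two sinks would give two increasing maximal chains. *)
Lemma sink_unique x u v z1 z2 : x \in W -> u \in W ->
  sink x u v z1 -> sink x u v z2 -> z1 = z2.
Proof.
move=> Wx Wu sink1 sink2.
have [w0 Ww0 w0T] := longest_element.
have [ws asc def_x] := ascending_word (groupM Ww0 Wx).
have [ws' asc' def_w0] := ascending_extend Ww0 w0T asc.
have Sall := ascending_all asc'.
have [ts1 def_ts ts1P] := labels_cat asc'.
have ts2P := labels_desc asc; rewrite def_x in ts1P ts2P.
have Tts := labels_refl Sall; rewrite def_ts in Tts.
have descE t : t \in T ->
    eta (w0 * x) (t ^ (w0 * x)^-1) = ~~ eta x (t ^ x^-1).
  move=> Tt; rewrite etaM // invMg conjgM conjgKV w0T //.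
  by rewrite !reflJ ?groupV.
(* In top degree the leading coefficient counts increasing maximal chains. *)
have lead a b : a \in W -> b \in W -> bruhat a b ->
    paths (ts1 ++ labels ws) b a (len b - len a) = 1%N.
  move=> Wa Wb ab; rewrite -def_ts -opw_paths // def_w0.
  by apply: (opw_leading Ww0 w0T asc' def_w0 Wb _ Wa).2;
     rewrite ?subnKC ?bruhat_len_le.
have split z : sink x u v z ->
    [/\ z \in W, len u <= len z <= len v,
        0 < paths ts1 v z (len v - len z) &
        0 < paths (labels ws) z u (len z - len u)].
  case=> uz zv zP; have Wz := bruhat_mem Wu uz; have Wv := bruhat_mem Wz zv.
  have /allP Tt := Tts.
  split=> //; first by rewrite !bruhat_len_le.
    apply: (@paths_prefix ts1 (labels ws)) => //; last by rewrite lead.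
    move=> t ts2t Nzt tzv; have {}Tt : t \in T.
      by apply: Tt; rewrite mem_cat ts2t orbT.
    (* Here [t * z] goes up while [x * (t * z)] goes down, so the cocycle gives [x * t < x],
       excluded for labels of [ws]. The other half is the mirror image. *)
    have := zP t Tt (bruhat_trans uz (bruhat_up Wz Tt Nzt)) tzv.
    rewrite etaM // conjgKV (negPf Nzt) addbF.
    by have := ts2P t ts2t; rewrite descE // => /negPf->.
  rewrite -(@paths_skip ts1) ?lead // => t ts1t zt utz.
  have {}Tt : t \in T by apply: Tt; rewrite mem_cat ts1t.
  have := zP t Tt utz (bruhat_trans (bruhat_down Wz Tt zt) zv).
  rewrite etaM // conjgKV zt.
  by have := ts1P t ts1t; rewrite descE // negbK => ->.
have [uz1 z1v _] := sink1; have Wz1 := bruhat_mem Wu uz1.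
have Wv := bruhat_mem Wz1 z1v; have uv := bruhat_trans uz1 z1v.
have [_ le1 p1 q1] := split _ sink1; have [_ le2 p2 q2] := split _ sink2.
apply/eqP; apply: contraT => neq.
have eq_k : (len v - len z1 + (len z1 - len u) =
             len v - len z2 + (len z2 - len u))%N by lia.
have := paths_cat_gt1 neq p1 q1 p2 q2 eq_k.
have -> : (len v - len z1 + (len z1 - len u) = len v - len u)%N by lia.
by rewrite lead.
Qed.

(** * Existence of sinks and the maximum of an interval *)

Definition bruhatb :=
  connect [rel a b | [exists t in T, ~~ eta a t && (b == t * a)]].

Lemma bruhatP a b : a \in W -> reflect (bruhat a b) (bruhatb a b).
Proof.
move=> Wa; apply: (iffP idP) => [/connectP[p] | /(clos_rt_rt1n gT) ab].
  elim: p a Wa => [a _ _ ->|c p IH a Wa /= /andP[/existsP[t]]].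
    exact: bruhat_refl.
  case/and3P => Tt Nat /eqP def_c cp lastb.
  apply: bruhat_trans (IH c _ cp lastb); rewrite def_c ?groupM //.
  exact: bruhat_up.
elim: ab Wa => [c|c d e cd _ IH] Wc; first exact: connect0.
have [t [Tt Nct def_d]] := (bruhat_stepP d Wc).1 cd.
apply: connect_trans (IH _); last by rewrite def_d groupM.
by apply/connect1/existsP; exists t; rewrite Tt Nct def_d /=.
Qed.

(** A choice of [z] with [x * z] longest is a sink: an ascent of [x * z] staying inside the interval
    would lengthen it further. *)
Lemma sink_above x u v y : x \in W -> u \in W ->
  bruhat u y -> bruhat y v ->
  exists2 z, sink x u v z & bruhat (x * y) (x * z).
Proof.
move=> Wx Wu uy yv; have Wy := bruhat_mem Wu uy.
have Wxy : x * y \in W by rewrite groupM.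
pose P z := [&& bruhatb u z, bruhatb z v & bruhatb (x * y) (x * z)].
have Py : P y by apply/and3P; split; apply/bruhatP => //; apply: bruhat_refl.
case: (@arg_maxnP _ y P (fun z => len (x * z)) Py) => z /and3P[].
move=> /(bruhatP _ Wu) uz + /(bruhatP _ Wxy) xyz max_z.
have Wz := bruhat_mem Wu uz; move=> /(bruhatP _ Wz) zv.
have Wxz : x * z \in W by rewrite groupM.
exists z => //; split=> // t Tt utz tzv; apply: contraT => Nxzt.
have Tt' : t ^ x^-1 \in T by rewrite reflJ ?groupV.
have def_xtz : x * (t * z) = t ^ x^-1 * (x * z) by rewrite !mulgA (conjgCV x).
have := max_z (t * z); rewrite /P def_xtz => lt_len.
have := eta_lenN Tt' Wxz Nxzt; rewrite ltnNge => /negP; case.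
apply: lt_len; apply/and3P; split; apply/bruhatP; rewrite ?groupM //.
exact: bruhat_trans xyz (bruhat_up Wxz Tt' Nxzt).
Qed.

Lemma interval_max x u v : x \in W -> u \in W -> bruhat u v ->
  exists z, [/\ bruhat u z, bruhat z v &
    forall y, bruhat u y -> bruhat y v -> bruhat (x * y) (x * z)].
Proof.
move=> Wx Wu uv.
have [z zP _] := sink_above Wx Wu (bruhat_refl u) uv.
have [uz zv _] := zP; exists z; split=> // y uy yv.
have [z' /(sink_unique Wx Wu zP) <-] := sink_above Wx Wu uy yv; exact.
Qed.

End CoxeterGroup.

(* With J = set0, W/W_J = cosets of <<set0>> = 1, i.e. singletons [set z];
   M is the set of singletons {z} with z in the Bruhat interval [u, v]. *)
Theorem theorem4p4 (gT : finGroupType) (W : {group gT}) (S : {set gT})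
    (HWS : coxeter_system W S) (u v : gT) (hu : u \in W) (hv : v \in W)
    (huv : bruhat_le W S u v) (M : {set {set gT}})
    (hM : forall A, A \in M <->
          exists z, [/\ A = [set z], z \in W, bruhat_le W S u z &
                        bruhat_le W S z v]) :
  coxeter_matroid W S set0 M.
Proof.
have [eta [etaM etaS]] := coxeter_sign_cocycle HWS.
have [SW defW S1 _] := HWS; have [len lenP] := length_function defW.
have Sinv : {in S, forall s, s * s = 1} by move=> s /S1[].
split; first exact: sub0set.
- apply/subsetP => A /hM[z [-> Wz _ _]].
  by apply/lcosetsP; exists z => //; rewrite gen0 mulg1.
- apply/set0Pn; exists [set u]; apply/hM; exists u; split=> //; exact: rt_refl.
move=> w Ww; have Ww' : w^-1 \in W by rewrite groupV.
have [z [uz zv max_z]] := interval_max SW Sinv etaM etaS lenP Ww' hu huv.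
have Wz := bruhat_mem SW Sinv etaM etaS lenP hu uz.
exists [set z]; split.
  split=> [|B /hM[y [-> Wy uy yv]]]; first by apply/hM; exists z.
  by exists y, z; split; rewrite ?set11 //; apply: max_z.
move=> A [/hM[z' [-> Wz' uz' z'v]] max_A].
have Mz : [set z] \in M by apply/hM; exists z.
(* A second maximum would lie both above and below [z] in the [w]-order; comparing lengths forces
   equality. *)
have [a [b [/set1P-> /set1P-> zz']]] := max_A _ Mz.
have Wwz : w^-1 * z \in W by rewrite groupM.
have Wwz' : w^-1 * z' \in W by rewrite groupM.
have z'z := max_z z' uz' z'v.
have := bruhat_len SW Sinv etaM etaS lenP Wwz zz'.
case=> [/mulgI-> // | lt_zz'].
by have := bruhat_len_le SW Sinv etaM etaS lenP Wwz' z'z; rewrite leqNgt lt_zz'.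
Qed.
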